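(* Let $\mathcal H$ be a finite-dimensional Hilbert space, let $\{|\psi_x\rangle\}_{x\in\mathsf X}$ be unit vectors in $\mathcal H$ given with prior probabilities $p_x$ ($\sum_xp_x=1$), and let $n\ge1$, $1\le k\le m$. Let $\tau:=\sum_xp_x\,\psi_x^{\otimes n}$ be the average input state. Then there is a quantum operation $\mathscr C^*_{n,m}$ from $\mathcal H^{\otimes n}$ to $\mathcal H^{\otimes m}$ that maximizes the average $k$-copy cloning fidelity $F_k[\mathscr C_{n,m}]$ over all quantum operations $\mathscr C_{n,m}$ with nonzero average success probability, and whose average success probability is $$P^*_{\rm succ}=\sum_xp_x\,\mathrm{tr}[\mathscr C^*_{n,m}(\psi_x^{\otimes n})]=\frac1{\|\tau^{-1}\|_\infty},$$ where $\|\tau^{-1}\|_\infty$ is the maximum eigenvalue of $\tau^{-1}$ (the inverse being taken on the support of $\tau$).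
   Context: $\psi_x:=|\psi_x\rangle\langle\psi_x|$. A quantum operation is a completely positive, trace non-increasing linear map. For a quantum operation $\mathscr C_{n,m}$ from $\mathcal H^{\otimes n}$ to $\mathcal H^{\otimes m}$ the average $k$-copy cloning fidelity (the quality of the clones being assessed on a uniformly random group of $k$ output systems) is $$F_k[\mathscr C_{n,m}]=\frac{\sum_xp_x\,\binom mk^{-1}\sum_{\mathsf S}\mathrm{tr}\big[(\psi_x^{\otimes k})_{\mathsf S}\,\mathscr C_{n,m}(\psi_x^{\otimes n})\big]}{\sum_xp_x\,\mathrm{tr}[\mathscr C_{n,m}(\psi_x^{\otimes n})]},$$ where $\mathsf S$ runs over all $k$-element subsets of the $m$ output systems and $(\psi_x^{\otimes k})_{\mathsf S}$ denotes $\psi_x^{\otimes k}$ acting on the systems in $\mathsf S$ tensored with the identity on the remaining ones. The denominator is the average success probability. *)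

(* Defs.v *)
From HB Require Import structures.
From mathcomp Require Import all_boot all_order all_algebra.
From mathcomp Require Import complex.
From mathcomp Require Import all_classical all_reals ereal numfun esum.

Set Implicit Arguments.
Unset Strict Implicit.
Unset Printing Implicit Defensive.

Import Order.TTheory GRing.Theory Num.Theory.

Local Open Scope ring_scope.
Local Open Scope sesquilinear_scope.
Local Open Scope complex_scope.

(* The Hilbert space is C^d, with C = R[i].                                   *)

Section Sums.
Variables (R : realType) (X : choiceType).

(* Sum of an absolutely summable family over an arbitrary index set, as the   *)
(* difference of the sums of its positive and negative parts.                 *)
Definition rsum (f : X -> R) : R :=
  let g x := (f x)%:E in
  fine (\esum_(x in [set: X]) (g^\+)%E x - \esum_(x in [set: X]) (g^\-)%E x)%E.

Definition csum (f : X -> R[i]) : R[i] :=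
  (rsum (fun x => complex.Re (f x))) +i* (rsum (fun x => complex.Im (f x))).

Definition is_prior (p : X -> R) : Prop :=
  (forall x, 0 <= p x) /\ (\esum_(x in [set: X]) (p x)%:E)%E = 1%E.

End Sums.

Section QuantumOperations.
Variable C : numClosedFieldType.

(* In a numClosedFieldType, 0 <= z entails that z is real; hence a psd matrix *)
(* is automatically Hermitian.                                                *)
Definition psd N (A : 'M[C]_N) : Prop :=
  forall v : 'cV[C]_N, 0 <= (v^t* *m A *m v) 0 0.

(* For every r, id_r (x) E maps positive semidefinite matrices to positive    *)
(* semidefinite ones; an element of M_r (x) M_N is an r x r block matrix with *)
(* blocks in M_N, on which id_r (x) E acts blockwise.                         *)
Definition completely_positive N M (E : {linear 'M[C]_N -> 'M[C]_M}) : Prop :=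
  forall (r : nat) (A : 'M[C]_(\sum_(i < r) N)),
    psd A -> psd (\mxblock_(i < r, j < r) E (submxblock A i j)).

Definition trace_nonincreasing N M (E : {linear 'M[C]_N -> 'M[C]_M}) : Prop :=
  forall A : 'M[C]_N, psd A -> \tr (E A) <= \tr A.

Definition quantum_operation N M (E : {linear 'M[C]_N -> 'M[C]_M}) : Prop :=
  completely_positive E /\ trace_nonincreasing E.

(* Inverse on the support, by functional calculus: A = U^-1 diag(a) U with U  *)
(* unitary (for A normal) is sent to U^-1 diag(a^-1) U, where 0^-1 = 0.       *)
Definition support_inv N (A : 'M[C]_N) : 'M[C]_N :=
  invmx (spectralmx A)
    *m diag_mx (map_mx (fun a : C => a^-1) (spectral_diag A))
    *m spectralmx A.

Definition is_max_eigenvalue N (A : 'M[C]_N) (a : C) : Prop :=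
  eigenvalue A a /\ forall b, eigenvalue A b -> b <= a.

End QuantumOperations.

Section Tensors.
Variables (C : numClosedFieldType) (d : nat).

(* The product basis of (C^d)^{(x) n} is indexed by the multi-indices         *)
(* {ffun 'I_n -> 'I_d}, themselves enumerated by 'I_(tdim n).                 *)
Definition tdim (n : nat) : nat := #|{: {ffun 'I_n -> 'I_d}}|.

Definition multi_index n (i : 'I_(tdim n)) : {ffun 'I_n -> 'I_d} :=
  enum_val i.

Definition tensor n (A : 'I_n -> 'M[C]_d) : 'M[C]_(tdim n) :=
  \matrix_(i, j) \prod_(a < n) A a (multi_index i a) (multi_index j a).

Definition proj (psi : 'cV[C]_d) : 'M[C]_d := psi *m psi^t*.

Definition tensor_power n (A : 'M[C]_d) : 'M[C]_(tdim n) :=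
  tensor (fun _ : 'I_n => A).

Definition acting_on n (S : {set 'I_n}) (A : 'M[C]_d) : 'M[C]_(tdim n) :=
  tensor (fun a : 'I_n => if a \in S then A else 1%:M).

End Tensors.

Section Cloning.
Variables (R : realType) (X : choiceType) (d : nat).
Variables (p : X -> R) (psi : X -> 'cV[R[i]]_d).

Definition avg_input n : 'M[R[i]]_(tdim d n) :=
  \matrix_(i, j) csum (fun x => (p x)%:C * tensor_power n (proj (psi x)) i j).

Section Operation.
Variables (n m : nat).
Variable E : {linear 'M[R[i]]_(tdim d n) -> 'M[R[i]]_(tdim d m)}.

Definition success_prob : R[i] :=
  csum (fun x => (p x)%:C * \tr (E (tensor_power n (proj (psi x))))).

Definition cloning_fidelity (k : nat) : R[i] :=
  csum (fun x => (p x)%:C *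
      (('C(m, k)%:R)^-1 * \sum_(S : {set 'I_m} | #|S| == k)
         \tr (acting_on S (proj (psi x)) *m
              E (tensor_power n (proj (psi x))))))
  / success_prob.

End Operation.
End Cloning.

(* Main.v *)
Require Import Defs.
From mathcomp Require Import all_boot all_order all_algebra.
From mathcomp Require Import complex.
From mathcomp Require Import all_classical all_reals ereal numfun esum.
From mathcomp Require Import ring lra.

Import Order.TTheory GRing.Theory Num.Theory.
Local Open Scope ring_scope.
Local Open Scope sesquilinear_scope.
Local Open Scope complex_scope.

(* With J the Choi matrix of an operation E, the success probability and the
   numerator of the fidelity are tr (J D) and tr (J B) for fixed matrices
   0 <= B <= D, where D is tau^T tensored with the identity.  Every Choi matrix
   is positive, so the fidelity is at most the largest generalized eigenvalue
   mu of the pair (B, D), and a rank-one J = w w^* with B w = mu D w and w in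
   the range of D attains it.  Such a J is the Choi matrix of A |-> W A W^*,
   where W lives on the support of tau.  The ratio does not change when W is
   rescaled, and scaling to tr (W tau W^* ) = 1 / lambda, with lambda the largest
   eigenvalue of tau^-1, gives tr (W^* W) <= lambda tr (W tau W^* ) = 1, so the
   operation is trace non-increasing. *)

Set Implicit Arguments.
Unset Strict Implicit.
Unset Printing Implicit Defensive.

(** * Averages over the prior *)

(** The inequality [le_scale] holds for every nonnegative scalar. Applied to [c^-1] and the scaled
    family it yields the converse, with [c = 0] set apart. *)
Lemma esumZl (R : realType) (X : choiceType) (c : R) (f : X -> \bar R) :
  0 <= c -> (forall x, 0 <= f x)%E ->
  (\esum_(x in [set: X]) (c%:E * f x) = c%:E * \esum_(x in [set: X]) f x)%E.
Proof.
have le_scale (a : R) (g : X -> \bar R) : 0 <= a -> (forall x, 0 <= g x)%E ->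
    (\esum_(x in [set: X]) (a%:E * g x) <= a%:E * \esum_(x in [set: X]) g x)%E.
  move=> a0 g0; apply: ge_ereal_sup => _ [F [finF FT]] <-.
  rewrite -ge0_mule_fsumr//; apply: lee_wpmul2l; first by rewrite lee_fin.
  by apply: esum_ge; exists F.
move=> c0 f0; apply/eqP; rewrite eq_le le_scale//=.
have [->|cn0] := eqVneq c 0.
  by rewrite mul0e; apply: esum_ge0 => x _; rewrite mul0e.
have cp : 0 < c by rewrite lt0r cn0.
have /(_ (fun x => c%:E * f x)%E) := le_scale c^-1.
rewrite invr_ge0 => /(_ c0) H.
have {H} : (\esum_(x in [set: X]) f x <=
    c^-1%:E * \esum_(x in [set: X]) (c%:E * f x))%E.
  apply: le_trans (H _) => [|x]; last by rewrite mule_ge0.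
  by apply: le_esum => x _; rewrite muleA -EFinM mulVf// mul1e.
move=> /(@lee_wpmul2l _ c%:E); rewrite lee_fin => /(_ c0).
by rewrite muleA -EFinM divff// mul1e.
Qed.

Section PriorAverage.
Variables (R : realType) (X : choiceType) (p : X -> R).
Hypothesis p_prior : is_prior p.

(** A bounded family weighted by the prior is absolutely summable, whatever the size of the index
    set. *)
Definition rbounded (h : X -> R) := exists M, forall x, `|h x| <= M.

Let S (f : X -> R) : \bar R := (\esum_(x in [set: X]) (p x * f x)%:E)%E.

Let S_fin f : rbounded f -> (forall x, 0 <= f x) -> S f \is a fin_num.
Proof.
case: p_prior => p0 p1 [M fM] f0; rewrite fin_numElt; apply/andP; split.
  apply: (@lt_le_trans _ _ 0%E); first by [].
  by apply: esum_ge0 => x _; rewrite lee_fin mulr_ge0.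
apply: (@le_lt_trans _ _ (\esum_(x in [set: X]) (`|M|%:E * (p x)%:E))%E).
  apply: le_esum => x _; rewrite -EFinM lee_fin mulrC ler_wpM2r//.
  by rewrite (le_trans (ler_norm _))// (le_trans (fM x))// ler_norm.
by rewrite esumZl ?p1 ?mule1 ?ltry.
Qed.

(** The prior has total mass 1, so adding [M] to the family moves its average by exactly [M], and
    the shifted family is nonnegative. Identities for [rsum] thus reduce to identities for [esum] of
    nonnegative families. *)
Lemma rsum_shift (h : X -> R) (M : R) : (forall x, `|h x| <= M) ->
  rsum (fun x => p x * h x) = fine (S (fun x => h x + M)) - M.
Proof.
case: (p_prior) => p0 p1 hM; rewrite /rsum.
have hge x : 0 <= h x + M by move: (hM x); rewrite ler_norml => /andP[]; lra.
(* Total mass 1 rules out an empty index set, and a point of [X] is what shows [M] to be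
   nonnegative. *)
case: (pselect (exists x : X, True)) => [[x0 _]|noX]; last first.
  exfalso; have : (\esum_(x in [set: X]) (p x)%:E)%E = 0%E.
    by apply: esum1 => x _; case: noX; exists x.
  by rewrite p1 => /eqP; rewrite onee_eq0.
have M0 : 0 <= M by rewrite (le_trans _ (hM x0)).
have bh : rbounded (fun x => h x + M).
  by exists (M + M) => x; rewrite (le_trans (ler_normD _ _))// lerD// ger0_norm.
have bM : rbounded (fun x : X => M) by exists M => x; rewrite ger0_norm.
have SM : S (fun=> M) = M%:E.
  rewrite /S (eq_esum (b := fun x => M%:E * (p x)%:E)%E).
    by rewrite esumZl ?p1 ?mule1.
  by move=> x _; rewrite -EFinM mulrC.
have summ f : rbounded f -> (forall x, 0 <= f x) ->
    summable [set: X] (fun x => (p x * f x)%:E).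
  move=> bf f0; rewrite summableE.
  rewrite (eq_esum (b := fun x => (p x * f x)%:E)); first exact: S_fin.
  by move=> x _; rewrite abse_EFin ger0_norm// mulr_ge0.
have := @esumB R X [set: X] (fun x => (p x * (h x + M))%:E)
  (fun x => (p x * M)%:E) (summ _ bh hge) (summ _ bM (fun=> M0)).
move=> H; transitivity (fine (S (fun x => h x + M)%R - S (fun=> M))); last first.
  by rewrite SM fineB// S_fin.
congr fine; rewrite -H; last 2 first.
- by move=> x _; rewrite lee_fin mulr_ge0.
- by move=> x _; rewrite lee_fin mulr_ge0.
have -> // : (fun x => (p x * h x)%:E) =
  ((fun x => (p x * (h x + M))%R%:E) \- (fun x => (p x * M)%R%:E))%E.
by apply/funext => x /=; rewrite -EFinB; congr EFin; ring.
Qed.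

Lemma rsumD_prior (h g : X -> R) : rbounded h -> rbounded g ->
  rsum (fun x => p x * (h x + g x)) =
  rsum (fun x => p x * h x) + rsum (fun x => p x * g x).
Proof.
case: (p_prior) => p0 p1 [M hM] [N gN].
have hge x : 0 <= h x + M by move: (hM x); rewrite ler_norml => /andP[]; lra.
have gge x : 0 <= g x + N by move: (gN x); rewrite ler_norml => /andP[]; lra.
rewrite (rsum_shift hM) (rsum_shift gN) (@rsum_shift _ (M + N)); last first.
  by move=> x; rewrite (le_trans (ler_normD _ _))// lerD.
have -> : S (fun x => h x + g x + (M + N)) =
    (S (fun x => h x + M)%R + S (fun x => g x + N)%R)%E.
  rewrite /S -esumD => [|x _|x _]; rewrite ?lee_fin ?mulr_ge0//.
  by apply: eq_esum => x _; rewrite -EFinD; congr EFin; ring.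
have b (f : X -> R) K : (forall x, `|f x| <= K) -> rbounded (fun x => f x + K).
  move=> fK; exists (K + `|K|) => x.
  by rewrite (le_trans (ler_normD _ _))// lerD.
by rewrite fineD ?S_fin//; [ring|exact: b|exact: b].
Qed.

Lemma rsum_prior_ge0 (h : X -> R) : (forall x, 0 <= h x) ->
  0 <= rsum (fun x => p x * h x).
Proof.
case: (p_prior) => p0 _ h0; rewrite /rsum.
apply: fine_ge0; rewrite [X in (_ - X)%E]esum1.
  by rewrite sube0; apply: esum_ge0 => x _; exact: funepos_ge0.
move=> x _; rewrite (@ge0_funenegE _ _ setT)//= ?inE//.
by move=> y _; rewrite lee_fin mulr_ge0.
Qed.

Lemma rsum_prior_cst (c : R) : rsum (fun x => p x * c) = c.
Proof.
case: (p_prior) => p0 p1.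
rewrite (@rsum_shift (fun=> c) `|c|)// /S.
have h : 0 <= c + `|c| by have := lerNnormlW (lexx `|c|); lra.
rewrite (eq_esum (b := fun x => (c + `|c|)%:E * (p x)%:E)%E).
  by rewrite esumZl// p1 mule1/=; ring.
by move=> x _; rewrite -EFinM mulrC.
Qed.

Lemma rsumN_prior (h : X -> R) : rbounded h ->
  rsum (fun x => p x * - h x) = - rsum (fun x => p x * h x).
Proof.
move=> bh; have bN : rbounded (fun x => - h x).
  by case: bh => M hM; exists M => x; rewrite normrN.
apply/eqP; rewrite -subr_eq0 opprK -rsumD_prior//.
rewrite [X in rsum X](_ : _ = fun x => p x * 0) ?rsum_prior_cst//.
by apply/funext => x; rewrite addNr.
Qed.

Lemma rsumZ_prior (c : R) (h : X -> R) : rbounded h ->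
  rsum (fun x => p x * (c * h x)) = c * rsum (fun x => p x * h x).
Proof.
case: (p_prior) => p0 p1.
(* Only for a nonnegative factor is [c * M] a bound for the scaled family; a negative factor goes
   through [rsumN_prior]. *)
wlog c0 : c / 0 <= c => [hw bh|].
  have [/hw-> //|c0] := leP 0 c.
  have /hw/(_ bh) e : 0 <= - c by rewrite oppr_ge0 ltW.
  apply: oppr_inj; rewrite -mulNr -e -rsumN_prior; last first.
    by case: bh => M hM; exists (`|c| * M) => x; rewrite normrM ler_wpM2l.
  by congr rsum; apply/funext => x; rewrite mulNr.
move=> [M hM].
have hge x : 0 <= h x + M by move: (hM x); rewrite ler_norml => /andP[]; lra.
rewrite (rsum_shift hM) (@rsum_shift _ (c * M)); last first.
  by move=> x; rewrite normrM (ger0_norm c0) ler_wpM2l.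
have -> : S (fun x => c * h x + c * M) = (c%:E * S (fun x => h x + M)%R)%E.
  rewrite /S -esumZl// => [|x]; last by rewrite lee_fin mulr_ge0.
  by apply: eq_esum => x _; rewrite -EFinM; congr EFin; ring.
rewrite fineM ?S_fin//=; first by ring.
by exists (M + `|M|) => x; rewrite (le_trans (ler_normD _ _))// lerD.
Qed.

Lemma rboundedD (h g : X -> R) :
  rbounded h -> rbounded g -> rbounded (fun x => h x + g x).
Proof.
by move=> [M hM] [N gN]; exists (M + N) => x; rewrite (le_trans (ler_normD _ _)) ?lerD.
Qed.

Lemma rboundedN (h : X -> R) : rbounded h -> rbounded (fun x => - h x).
Proof. by move=> [M hM]; exists M => x; rewrite normrN. Qed.

Lemma rboundedM (h g : X -> R) :
  rbounded h -> rbounded g -> rbounded (fun x => h x * g x).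
Proof.
by move=> [M hM] [N gN]; exists (M * N) => x; rewrite normrM ler_pM.
Qed.

(** * Averages of bounded complex families *)

Definition cbounded (F : X -> R[i]) :=
  rbounded (fun x => complex.Re (F x)) /\ rbounded (fun x => complex.Im (F x)).

Lemma cboundedD (F G : X -> R[i]) :
  cbounded F -> cbounded G -> cbounded (fun x => F x + G x).
Proof.
move=> [Fr Fi] [Gr Gi]; split.
  rewrite (_ : (fun x => _) = fun x => complex.Re (F x) + complex.Re (G x)).
    exact: rboundedD.
  by apply/funext => x; case: (F x) (G x) => [? ?] [? ?].
rewrite (_ : (fun x => _) = fun x => complex.Im (F x) + complex.Im (G x)).
  exact: rboundedD.
by apply/funext => x; case: (F x) (G x) => [? ?] [? ?].
Qed.

Lemma cboundedM (F G : X -> R[i]) :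
  cbounded F -> cbounded G -> cbounded (fun x => F x * G x).
Proof.
move=> [Fr Fi] [Gr Gi]; split.
  rewrite (_ : (fun x => _) = fun x => complex.Re (F x) * complex.Re (G x) +
    - (complex.Im (F x) * complex.Im (G x))).
    by apply: rboundedD; [|apply: rboundedN]; exact: rboundedM.
  by apply/funext => x; case: (F x) (G x) => [? ?] [? ?].
rewrite (_ : (fun x => _) = fun x => complex.Re (F x) * complex.Im (G x) +
    complex.Im (F x) * complex.Re (G x)).
  by apply: rboundedD; exact: rboundedM.
by apply/funext => x; case: (F x) (G x) => [? ?] [? ?].
Qed.

Lemma cbounded_conj (F : X -> R[i]) :
  cbounded F -> cbounded (fun x => (F x)^*%R).
Proof.
move=> [Fr Fi]; split.
  rewrite (_ : (fun x => _) = fun x => complex.Re (F x))//.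
  by apply/funext => x; case: (F x).
rewrite (_ : (fun x => _) = fun x => - complex.Im (F x)); first exact: rboundedN.
by apply/funext => x; case: (F x).
Qed.

Lemma cbounded_cst (c : R[i]) : cbounded (fun=> c).
Proof. by split; [exists `|complex.Re c| | exists `|complex.Im c|]. Qed.

Lemma cbounded_sum I (r : seq I) (P : pred I) (F : I -> X -> R[i]) :
  (forall i, P i -> cbounded (F i)) ->
  cbounded (fun x => \sum_(i <- r | P i) F i x).
Proof.
move=> bF; elim: r => [|i r IH].
  rewrite (_ : (fun x => _) = fun=> 0); first exact: cbounded_cst.
  by apply/funext => x; rewrite big_nil.
case Pi : (P i); last first.
  rewrite (_ : (fun x => _) = fun x => \sum_(j <- r | P j) F j x)//.
  by apply/funext => x; rewrite big_cons Pi.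
rewrite (_ : (fun x => _) = fun x => F i x + \sum_(j <- r | P j) F j x).
  exact/cboundedD/IH/bF.
by apply/funext => x; rewrite big_cons Pi.
Qed.

Lemma cbounded_prod I (r : seq I) (F : I -> X -> R[i]) :
  (forall i, cbounded (F i)) -> cbounded (fun x => \prod_(i <- r) F i x).
Proof.
move=> bF; elim: r => [|i r IH].
  rewrite (_ : (fun x => _) = fun=> 1); first exact: cbounded_cst.
  by apply/funext => x; rewrite big_nil.
rewrite (_ : (fun x => _) = fun x => F i x * \prod_(j <- r) F j x).
  exact: cboundedM.
by apply/funext => x; rewrite big_cons.
Qed.

(** Up to unfolding, the entries of [avg_input], the success probability and the numerator of the
    fidelity are all of this shape. *)
Definition avg (F : X -> R[i]) : R[i] := csum (fun x => (p x)%:C * F x).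

Lemma avgE (F : X -> R[i]) : avg F =
  rsum (fun x => p x * complex.Re (F x)) +i* rsum (fun x => p x * complex.Im (F x)).
Proof.
by congr Complex; congr rsum; apply/funext => x; case: (F x) => a b /=;
  rewrite mul0r ?subr0 ?addr0.
Qed.

Lemma avgD (F G : X -> R[i]) : cbounded F -> cbounded G ->
  avg (fun x => F x + G x) = avg F + avg G.
Proof.
move=> [Fr Fi] [Gr Gi]; rewrite !avgE; apply/eqP; rewrite eq_complex/=.
by rewrite -!rsumD_prior//; apply/andP; split; apply/eqP; congr rsum;
  apply/funext => x; case: (F x) (G x) => [? ?] [? ?].
Qed.

Lemma avgZ (c : R[i]) (F : X -> R[i]) : cbounded F ->
  avg (fun x => c * F x) = c * avg F.
Proof.
move=> [Fr Fi]; rewrite !avgE; case: c => a b; apply/eqP; rewrite eq_complex/=.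
have bZ (t : R) (h : X -> R) : rbounded h -> rbounded (fun x => t * h x).
  by apply: rboundedM; exists `|t|.
apply/andP; split; apply/eqP.
  rewrite -!rsumZ_prior// -rsumN_prior; last exact: bZ.
  rewrite -rsumD_prior; [|exact: bZ|exact/rboundedN/bZ].
  by congr rsum; apply/funext => x; case: (F x).
rewrite -!rsumZ_prior// -rsumD_prior; [|exact: bZ|exact: bZ].
by congr rsum; apply/funext => x; case: (F x).
Qed.

Lemma avg_cst (c : R[i]) : avg (fun=> c) = c.
Proof. by rewrite avgE !rsum_prior_cst; case: c. Qed.

Lemma avg_ge0 (F : X -> R[i]) : (forall x, 0 <= F x) -> 0 <= avg F.
Proof.
move=> F0; rewrite avgE lecE/=; apply/andP; split.
  (* In the order of [R[i]] a nonnegative number has zero imaginary part, so the imaginary parts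
     average to the constant 0. *)
  rewrite (_ : (fun x => _) = fun x => p x * 0) ?rsum_prior_cst//.
  by apply/funext => x; rewrite ger0_Im.
apply: rsum_prior_ge0 => x; have := F0 x.
by rewrite lecE => /andP[].
Qed.

Lemma avg_sum I (r : seq I) (P : pred I) (F : I -> X -> R[i]) :
  (forall i, P i -> cbounded (F i)) ->
  avg (fun x => \sum_(i <- r | P i) F i x) = \sum_(i <- r | P i) avg (F i).
Proof.
move=> bF; elim: r => [|i r IH].
  rewrite big_nil -[RHS]avg_cst; congr avg.
  by apply/funext => x; rewrite big_nil.
rewrite big_cons; case: ifPn => Pi; last first.
  by rewrite -IH; congr avg; apply/funext => x; rewrite big_cons (negPf Pi).
rewrite -IH -avgD; [|exact: bF|exact: cbounded_sum].
by congr avg; apply/funext => x; rewrite big_cons Pi.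
Qed.

(** * Entrywise averages of matrices *)

Definition mavg n m (F : X -> 'M[R[i]]_(n, m)) : 'M[R[i]]_(n, m) :=
  \matrix_(i, j) avg (fun x => F x i j).

Definition mbounded n m (F : X -> 'M[R[i]]_(n, m)) :=
  forall i j, cbounded (fun x => F x i j).

Lemma mbounded_cst n m (A : 'M[R[i]]_(n, m)) : mbounded (fun=> A).
Proof. by move=> i j; exact: cbounded_cst. Qed.

Lemma mboundedD n m (F G : X -> 'M[R[i]]_(n, m)) :
  mbounded F -> mbounded G -> mbounded (fun x => F x + G x).
Proof.
move=> bF bG i j; rewrite (_ : (fun x => _) = fun x => F x i j + G x i j).
  exact: cboundedD.
by apply/funext => x; rewrite mxE.
Qed.

Lemma mboundedM n m r (F : X -> 'M[R[i]]_(n, m)) (G : X -> 'M[R[i]]_(m, r)) :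
  mbounded F -> mbounded G -> mbounded (fun x => F x *m G x).
Proof.
move=> bF bG i j; rewrite (_ : (fun x => _) = fun x => \sum_k F x i k * G x k j).
  by apply: cbounded_sum => k _; exact: cboundedM.
by apply/funext => x; rewrite mxE.
Qed.

Lemma mboundedZ n m (c : R[i]) (F : X -> 'M[R[i]]_(n, m)) :
  mbounded F -> mbounded (fun x => c *: F x).
Proof.
move=> bF i j; rewrite (_ : (fun x => _) = fun x => c * F x i j).
  by apply: cboundedM => //; exact: cbounded_cst.
by apply/funext => x; rewrite mxE.
Qed.

Lemma mbounded_sum n m I (r : seq I) (P : pred I) (F : I -> X -> 'M[R[i]]_(n, m)) :
  (forall i, P i -> mbounded (F i)) ->
  mbounded (fun x => \sum_(i <- r | P i) F i x).
Proof.
move=> bF i j.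
rewrite (_ : (fun x => _) = fun x => \sum_(k <- r | P k) F k x i j).
  by apply: cbounded_sum => k Pk; exact: bF.
by apply/funext => x; rewrite summxE.
Qed.

Lemma mavgD n m (F G : X -> 'M[R[i]]_(n, m)) : mbounded F -> mbounded G ->
  mavg (fun x => F x + G x) = mavg F + mavg G.
Proof.
move=> bF bG; apply/matrixP => i j; rewrite !mxE -avgD//.
by congr avg; apply/funext => x; rewrite mxE.
Qed.

Lemma mavgMl n m r (A : 'M[R[i]]_(n, m)) (F : X -> 'M[R[i]]_(m, r)) :
  mbounded F -> mavg (fun x => A *m F x) = A *m mavg F.
Proof.
move=> bF; apply/matrixP => i j; rewrite !mxE.
under eq_bigr => k _ do rewrite mxE -avgZ//.
rewrite -avg_sum.
  by congr avg; apply/funext => x; rewrite mxE.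
by move=> k _; apply: cboundedM => //; exact: cbounded_cst.
Qed.

Lemma mavgMr n m r (A : 'M[R[i]]_(m, r)) (F : X -> 'M[R[i]]_(n, m)) :
  mbounded F -> mavg (fun x => F x *m A) = mavg F *m A.
Proof.
move=> bF; apply/matrixP => i j; rewrite !mxE.
under eq_bigr => k _ do rewrite mxE mulrC -avgZ//.
rewrite -avg_sum.
  by congr avg; apply/funext => x; rewrite mxE; apply: eq_bigr => k _; exact: mulrC.
by move=> k _; apply: cboundedM => //; exact: cbounded_cst.
Qed.

Lemma tr_mavg n (F : X -> 'M[R[i]]_n) : mbounded F ->
  \tr (mavg F) = avg (fun x => \tr (F x)).
Proof.
move=> bF; rewrite /mxtrace avg_sum//.
by apply: eq_bigr => k _; rewrite mxE.
Qed.

(** The quadratic form at a fixed vector is linear in the matrix, hence commutes with the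
    average. *)
Lemma psd_mavg n (F : X -> 'M[R[i]]_n) : mbounded F ->
  (forall x, psd (F x)) -> psd (mavg F).
Proof.
move=> bF pF v; rewrite -mavgMl// -mavgMr.
  by rewrite mxE; apply: avg_ge0 => x; exact: pF.
by apply: mboundedM => //; exact: mbounded_cst.
Qed.

End PriorAverage.

(** * Positive semidefinite matrices *)

Section Psd.
Variable C : numClosedFieldType.

Lemma adjmxM m n r (A : 'M[C]_(m, n)) (B : 'M_(n, r)) :
  (A *m B)^t* = B^t* *m A^t*.
Proof. by rewrite trmx_mul map_mxM. Qed.

Lemma adjmxD m n (A B : 'M[C]_(m, n)) : (A + B)^t* = A^t* + B^t*.
Proof. by rewrite linearD/= map_mxD. Qed.

Lemma adjmxB m n (A B : 'M[C]_(m, n)) : (A - B)^t* = A^t* - B^t*.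
Proof. by rewrite linearB/= map_mxB. Qed.

Lemma adjmx1 n : (1%:M : 'M[C]_n)^t* = 1%:M.
Proof. by rewrite trmx1 map_mx1. Qed.

Lemma gram_ge0 n (v : 'cV[C]_n) : 0 <= (v^t* *m v) 0 0.
Proof.
rewrite mxE; apply: sumr_ge0 => i _; rewrite !mxE mulrC.
exact: mul_conjC_ge0.
Qed.

Lemma psd_gram m n (X : 'M[C]_(m, n)) : psd (X^t* *m X).
Proof.
by move=> v; rewrite mulmxA -mulmxA -adjmxM; exact: gram_ge0.
Qed.

Lemma psd_conj m n (X : 'M[C]_(m, n)) A : psd A -> psd (X^t* *m A *m X).
Proof.
move=> Apsd v; have := Apsd (X *m v).
by rewrite adjmxM !mulmxA.
Qed.

Lemma psdD n (A B : 'M[C]_n) : psd A -> psd B -> psd (A + B).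
Proof.
by move=> pA pB v; rewrite mulmxDr mulmxDl mxE addr_ge0 ?pA ?pB.
Qed.

Lemma psdZ n (c : C) (A : 'M[C]_n) : 0 <= c -> psd A -> psd (c *: A).
Proof.
by move=> c0 pA v; rewrite -scalemxAr -scalemxAl mxE mulr_ge0 ?pA.
Qed.

Lemma psd0 n : psd (0 : 'M[C]_n).
Proof. by move=> v; rewrite mulmx0 mul0mx mxE. Qed.

Lemma psd_sum n (I : Type) (r : seq I) (P : pred I) (F : I -> 'M[C]_n) :
  (forall i, P i -> psd (F i)) -> psd (\sum_(i <- r | P i) F i).
Proof. by move=> pF; elim/big_ind: _ => //; [exact: psd0|exact: psdD]. Qed.

Lemma psd_proj n (A : 'M[C]_n) : A^t* = A -> A *m A = A -> psd A.
Proof. by move=> hA iA; rewrite -iA -{1}hA; exact: psd_gram. Qed.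

Lemma psd_diag n (A : 'M[C]_n) i : psd A -> 0 <= A i i.
Proof.
move=> /(_ (delta_mx i 0)).
by rewrite trmx_delta map_delta_mx -rowE -colE !mxE.
Qed.

Lemma psd_tr_ge0 n (A : 'M[C]_n) : psd A -> 0 <= \tr A.
Proof. by move=> pA; apply: sumr_ge0 => i _; exact: psd_diag. Qed.

(** Polarization: the sesquilinear form [q] of [A^t* - A] vanishes on the diagonal because the
    quadratic form of [A] is real. Expanding [q] at [u + v] makes it antisymmetric. *)
Lemma psd_herm n (A : 'M[C]_n) : psd A -> A^t* = A.
Proof.
move=> pA; pose q (u v : 'cV[C]_n) := (u^t* *m (A^t* - A) *m v) 0 0.
have q0 v : q v v = 0.
  rewrite /q; have -> : v^t* *m (A^t* - A) *m v = (v^t* *m A *m v)^t* - v^t* *m A *m v.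
    by rewrite !adjmxM trmxCK mulmxBr mulmxBl mulmxA.
  have /ger0_real/CrealP := pA v.
  by move: (v^t* *m A *m v) => G; rewrite !mxE => ->; rewrite subrr.
have qs u v : q u v = - q v u.
  have : q (u + v) (u + v) = q u u + q v u + (q u v + q v v).
    have mxD (G H : 'M[C]_1) : (G + H) 0 0 = G 0 0 + H 0 0 by rewrite mxE.
    by rewrite /q adjmxD !(mulmxDl, mulmxDr) !mxD.
  rewrite !q0 add0r addr0 => /esym/eqP; rewrite addrC addr_eq0 => /eqP.
  exact.
apply/eqP; rewrite -subr_eq0; apply/eqP/matrixP => i j.
pose u : 'cV[C]_n := delta_mx i 0; pose v : 'cV[C]_n := delta_mx j 0.
have quv : q u v = (A^t* - A) i j.
  by rewrite /q trmx_delta map_delta_mx -rowE -colE !mxE.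
have e1 : q u ('i *: v) = 'i * q u v.
  by rewrite /q -scalemxAr mxE.
have e2 : q ('i *: v) u = - 'i * q v u.
  by rewrite /q linearZ/= map_mxZ -!scalemxAl mxE/= conjCi.
(* The first argument of [q] is conjugate-linear, so antisymmetry at ['i *: v] turns into symmetry
   at [v]; the two together force [q = 0]. *)
have := qs u ('i *: v); rewrite e1 e2 (qs u v).
move=> /eqP; rewrite mulNr opprK mulrN -subr_eq0 -opprD oppr_eq0 -mulr2n.
rewrite mulrn_eq0/= mulf_eq0 (negPf (neq0Ci _))/= => /eqP e.
by rewrite -quv qs e oppr0 mxE.
Qed.

Lemma psd_spectral n (A : 'M[C]_n) : psd A ->
  A = (spectralmx A)^t* *m diag_mx (spectral_diag A) *m spectralmx A.
Proof.
move=> pA; rewrite -invmx_unitary ?spectral_unitarymx//.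
by apply/orthomx_spectralP/normalmxP; rewrite psd_herm.
Qed.

(** Functional calculus in a fixed eigenbasis. All functions of one matrix share [U] and [a], so
    their identities reduce to scalar ones at the eigenvalues. *)
Definition mxfun n (U : 'M[C]_n) (a : 'rV[C]_n) (f : C -> C) : 'M[C]_n :=
  U^t* *m diag_mx (map_mx f a) *m U.

Lemma mxfunM n (U : 'M[C]_n) a f g : U \is unitarymx ->
  mxfun U a f *m mxfun U a g = mxfun U a (fun z => f z * g z).
Proof.
move=> Uu; rewrite /mxfun !mulmxA mulmxtVK//.
congr (_ *m _); rewrite -!mulmxA; congr (_ *m _).
by rewrite mulmx_diag; congr diag_mx; apply/rowP => i; rewrite !mxE.
Qed.

Lemma adj_mxfun n (U : 'M[C]_n) a f :
  (mxfun U a f)^t* = mxfun U a (fun z => (f z)^*%R).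
Proof.
rewrite /mxfun !adjmxM trmxCK mulmxA tr_diag_mx map_diag_mx.
by congr (_ *m diag_mx _ *m _); apply/rowP => i; rewrite !mxE.
Qed.

Lemma mxfun_conjE n (U : 'M[C]_n) a f i : U \is unitarymx ->
  (U *m mxfun U a f *m U^t*) i i = f (a 0 i).
Proof.
move=> Uu; rewrite /mxfun !mulmxA mulmxtVK// (unitarymxP Uu) mul1mx.
by rewrite !mxE eqxx mulr1n.
Qed.

Lemma eq_mxfun n (U : 'M[C]_n) (a : 'rV[C]_n) (f g : C -> C) :
  (forall i, f (a 0 i) = g (a 0 i)) -> mxfun U a f = mxfun U a g.
Proof.
by move=> fg; congr (_ *m diag_mx _ *m _); apply/rowP => i; rewrite !mxE.
Qed.

Lemma mxfun1 n (U : 'M[C]_n) a : U \is unitarymx -> mxfun U a (fun=> 1) = 1%:M.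
Proof.
move=> Uu; rewrite /mxfun (_ : diag_mx _ = 1%:M) ?mulmx1.
  by apply: mulmx1C; exact/unitarymxP.
by rewrite -diag_const_mx; congr diag_mx; apply/rowP => i; rewrite !mxE.
Qed.

Lemma mxfunB n (U : 'M[C]_n) a f g :
  mxfun U a f - mxfun U a g = mxfun U a (fun z => f z - g z).
Proof.
rewrite /mxfun -mulmxBl -mulmxBr -linearB/=.
by congr (_ *m diag_mx _ *m _); apply/rowP => i; rewrite !mxE.
Qed.

Lemma mxfunZ n (U : 'M[C]_n) a c f :
  c *: mxfun U a f = mxfun U a (fun z => c * f z).
Proof.
rewrite /mxfun scalemxAl scalemxAr -linearZ/=.
by congr (_ *m diag_mx _ *m _); apply/rowP => i; rewrite !mxE.
Qed.

Lemma psd_mxfun n (U : 'M[C]_n) (a : 'rV[C]_n) (f : C -> C) :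
  (forall i, 0 <= f (a 0 i)) ->
  psd (mxfun U a f).
Proof.
move=> f0; apply: psd_conj => v.
rewrite mul_mx_diag mxE; apply: sumr_ge0 => i _; rewrite !mxE mulrAC.
by rewrite mulr_ge0// mulrC mul_conjC_ge0.
Qed.

Lemma psd_mxfunE n (A : 'M[C]_n) : psd A ->
  A = mxfun (spectralmx A) (spectral_diag A) id.
Proof.
move=> pA; rewrite /mxfun (_ : map_mx id _ = spectral_diag A) -?psd_spectral//.
by apply/rowP => i; rewrite mxE.
Qed.

(** An eigenvalue is a diagonal entry of [A] conjugated into its eigenbasis. *)
Lemma psd_spectral_ge0 n (A : 'M[C]_n) i : psd A -> 0 <= spectral_diag A 0 i.
Proof.
move=> pA; have Uu := spectral_unitarymx A.
rewrite -[X in 0 <= X](mxfun_conjE (spectral_diag A) id i Uu) -psd_mxfunE//.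
apply: psd_diag; rewrite -{1}(trmxCK (spectralmx A)).
exact: psd_conj.
Qed.

Lemma mxtrace_mxfunM n (U : 'M[C]_n) a f (B : 'M[C]_n) : 
  \tr (mxfun U a f *m B) = \sum_i f (a 0 i) * (U *m B *m U^t*) i i.
Proof.
rewrite /mxfun -!mulmxA mxtrace_mulC -!mulmxA mul_diag_mx.
by apply: eq_bigr => i _; rewrite !mxE.
Qed.

Lemma psd_trM_ge0 n (A B : 'M[C]_n) : psd A -> psd B -> 0 <= \tr (A *m B).
Proof.
move=> pA pB; rewrite [X in X *m _]psd_mxfunE// mxtrace_mxfunM.
apply: sumr_ge0 => i _; rewrite mulr_ge0 ?psd_spectral_ge0//.
by apply: psd_diag; rewrite -{1}(trmxCK (spectralmx A)); exact: psd_conj.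
Qed.

Lemma psd_trE n (A : 'M[C]_n) : psd A -> \tr A = \sum_i spectral_diag A 0 i.
Proof.
move=> pA; rewrite -[X in \tr X]mulmx1 [X in X *m _]psd_mxfunE// mxtrace_mxfunM.
apply: eq_bigr => i _; rewrite mulmx1 (unitarymxP (spectral_unitarymx A)).
by rewrite !mxE eqxx mulr1.
Qed.

(** In the eigenbasis of [A] the left side weights the diagonal entries of the conjugated [B] by
    eigenvalues of [A]; each such entry is at most the trace of [B]. *)
Lemma psd_trM_le n (A B : 'M[C]_n) : psd A -> psd B ->
  \tr (A *m B) <= \tr A * \tr B.
Proof.
move=> pA pB; rewrite [X in X *m _]psd_mxfunE// mxtrace_mxfunM psd_trE//.
rewrite mulr_suml; apply: ler_sum => i _; apply: ler_wpM2l.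
  exact: psd_spectral_ge0.
have pB' : psd (spectralmx A *m B *m (spectralmx A)^t*).
  by rewrite -{1}(trmxCK (spectralmx A)); exact: psd_conj.
have <- : \tr (spectralmx A *m B *m (spectralmx A)^t*) = \tr B.
  rewrite -mulmxA mxtrace_mulC -mulmxA (_ : (spectralmx A)^t* *m _ = 1%:M) ?mulmx1//.
  by apply: mulmx1C; exact/unitarymxP/spectral_unitarymx.
rewrite /mxtrace (bigD1 i)//= lerDl; apply: sumr_ge0 => j _.
exact: psd_diag.
Qed.

Lemma psd_tr_eq0 n (A : 'M[C]_n) : psd A -> \tr A = 0 -> A = 0.
Proof.
move=> pA; rewrite psd_trE// => /eqP.
rewrite psumr_eq0 => [/allP a0|i _]; last exact: psd_spectral_ge0.
rewrite [LHS]psd_mxfunE// (@eq_mxfun _ _ _ id (fun=> 0)) => [|i].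
  rewrite /mxfun (_ : diag_mx _ = 0) ?mulmx0 ?mul0mx//.
  by rewrite (_ : map_mx _ _ = 0) ?linear0//; apply/rowP => i; rewrite !mxE.
by apply/eqP/a0; rewrite mem_index_enum.
Qed.

Lemma psd_antisym n (A : 'M[C]_n) : psd A -> psd (- A) -> A = 0.
Proof.
move=> pA pN; apply: psd_tr_eq0 => //; apply/eqP; rewrite eq_le psd_tr_ge0//.
by rewrite -oppr_ge0 -raddfN psd_tr_ge0.
Qed.

(** With [T] the square root of [B], the hypothesis says that the Gram matrix of [T *m X] is
    zero. *)
Lemma psd_form_eq0 m n (B : 'M[C]_n) (X : 'M[C]_(n, m)) :
  psd B -> X^t* *m B *m X = 0 -> B *m X = 0.
Proof.
move=> pB XBX; have Uu := spectral_unitarymx B.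
set T := mxfun (spectralmx B) (spectral_diag B) sqrtC.
have TE : T^t* = T.
  rewrite adj_mxfun; apply: eq_mxfun => i; apply/CrealP/ger0_real.
  by rewrite sqrtC_ge0 psd_spectral_ge0.
have BE : B = T *m T.
  rewrite mxfunM// [LHS]psd_mxfunE//; apply: eq_mxfun => i.
  by rewrite -expr2 sqrtCK.
suff TX : T *m X = 0 by rewrite BE -mulmxA TX mulmx0.
have G0 : (T *m X)^t* *m (T *m X) = 0.
  by rewrite adjmxM TE -mulmxA (mulmxA T) -BE mulmxA.
(* The diagonal entries of the Gram matrix are squared column norms, so every column vanishes. *)
apply/matrixP => i j; have /matrixP/(_ j j) := G0.
rewrite [RHS]mxE [LHS]mxE => /eqP; rewrite psumr_eq0 => [|k _].
  move=> /allP/(_ i); rewrite mem_index_enum => /(_ isT).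
  by rewrite !mxE mulf_eq0 conjC_eq0 orbb => /eqP ->.
by rewrite !mxE mulrC mul_conjC_ge0.
Qed.

(** The order of [C] is only partial, but nonnegative elements are comparable; [i0] excludes the
    empty family. *)
Lemma max_nonneg n (a : 'I_n -> C) (i0 : 'I_n) : (forall i, 0 <= a i) ->
  exists i, forall j, a j <= a i.
Proof.
move=> a0; suff : forall s : seq 'I_n, exists i, forall j, j \in s -> a j <= a i.
  by move=> /(_ (enum 'I_n))[i H]; exists i => j; rewrite H// mem_enum.
elim=> [|k s [i IH]]; first by exists i0.
case/orP: (ger_leVge (a0 k) (a0 i)) => ki.
  by exists i => j; rewrite inE => /orP[/eqP->//|]; exact: IH.
exists k => j; rewrite inE => /orP[/eqP->//|js].
exact: le_trans (IH _ js) ki.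
Qed.

End Psd.

(** * Choi matrices *)

Section Choi.
Variable C : numClosedFieldType.

(** With [S] the inverse square root of [D] on its support, [mu] is the largest eigenvalue of
    [S *m B *m S] and [w] is [S] applied to a unit eigenvector. The bound by [c *: D] confines [B]
    to the support of [D]; the bound [D <= B] makes [mu] nonzero, which places the eigenvector in
    that support. *)
Lemma psd_ratio_max N (B D : 'M[C]_N) (c : C) : psd D -> D != 0 ->
  psd (B - D) -> psd (c *: D - B) ->
  exists mu : C, exists u : 'cV[C]_N, let w := D *m u in
    [/\ psd (mu *: D - B), (w^t* *m B *m w) 0 0 = mu & (w^t* *m D *m w) 0 0 = 1].
Proof.
move=> pD D0 pBD pcDB.
have pB : psd B by rewrite -(subrK D B); exact: psdD.
have [i0] : exists i0 : 'I_N, True.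
  case: N => [|N'] in B D pD D0 pBD pcDB pB *; last by exists ord0.
  by move: D0; rewrite flatmx0 eqxx.
move=> _; have Uu := spectral_unitarymx D.
set U := spectralmx D in Uu; set a := spectral_diag D.
have a0 i : 0 <= a 0 i by exact: psd_spectral_ge0.
(* [T] is the square root of [D], [S] its inverse on the support, and [P] the support projector;
   [0^-1 = 0] makes these formulas correct on the kernel too. *)
pose T := mxfun U a sqrtC; pose S := mxfun U a (fun z => (sqrtC z)^-1).
pose P := mxfun U a (fun z => z * z^-1).
have sr i : 0 <= sqrtC (a 0 i) by rewrite sqrtC_ge0.
have TE : T^t* = T.
  by rewrite adj_mxfun; apply: eq_mxfun => i; apply/CrealP/ger0_real.
have SE : S^t* = S.
  rewrite adj_mxfun; apply: eq_mxfun => i; apply/CrealP/ger0_real.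
  by rewrite invr_ge0.
have DE : D = mxfun U a id by exact: psd_mxfunE.
have TT : T *m T = D.
  by rewrite mxfunM// DE; apply: eq_mxfun => i; rewrite -expr2 sqrtCK.
have PE : P^t* = P.
  rewrite adj_mxfun; apply: eq_mxfun => i; apply/CrealP/ger0_real.
  by rewrite mulr_ge0 ?invr_ge0.
have ST : S *m T = P.
  rewrite mxfunM//; apply: eq_mxfun => i.
  have [->|an0] := eqVneq (a 0 i) 0; first by rewrite sqrtC0 mul0r mulr0.
  by rewrite mulVf ?sqrtC_eq0// divff.
have TS : T *m S = P by rewrite -PE -ST adjmxM SE TE.
have DP : D *m P = D.
  rewrite {1}DE mxfunM// DE; apply: eq_mxfun => i.
  have [->|an0] := eqVneq (a 0 i) 0; first by rewrite mul0r.
  by rewrite divff// mulr1.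
have PS : P *m S = S.
  rewrite mxfunM//; apply: eq_mxfun => i.
  have [->|an0] := eqVneq (a 0 i) 0; first by rewrite sqrtC0 invr0 mulr0.
  by rewrite divff// mul1r.
clearbody T S P.
(* On the kernel of [D] the form of [B] is squeezed between 0 and [c] times that of [D], which is
   0. *)
have BY (Y : 'M[C]_N) : D *m Y = 0 -> B *m Y = 0.
  move=> DY; apply: psd_form_eq0 => //; apply: psd_antisym; first exact: psd_conj.
  have := psd_conj Y pcDB.
  by rewrite mulmxBr mulmxBl -scalemxAr -scalemxAl -(mulmxA _ D) DY mulmx0 scaler0 sub0r.
have BP : B *m P = B.
  apply/eqP; rewrite eq_sym -subr_eq0 -{1}[B]mulmx1 -mulmxBr; apply/eqP/BY.
  by rewrite mulmxBr mulmx1 DP subrr.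
have PB : P *m B = B by rewrite -[in LHS](psd_herm pB) -PE -adjmxM BP psd_herm.
pose H := S *m B *m S.
have pH : psd H by rewrite /H -{1}SE; exact: psd_conj.
have Vu := spectral_unitarymx H.
set V := spectralmx H in Vu; set h := spectral_diag H.
have h0 i : 0 <= h 0 i by exact: psd_spectral_ge0.
have HE : H = mxfun V h id by exact: psd_mxfunE.
have [i hmax] := max_nonneg i0 h0.
set mu := h 0 i in hmax.
have pmu : psd (mu *: D - B).
  have -> : mu *: D - B = T^t* *m (mxfun V h (fun=> mu * 1) - mxfun V h id) *m T.
    rewrite -HE -mxfunZ mxfun1// mulmxBr mulmxBl TE -scalemxAr -scalemxAl mulmx1 TT.
    by rewrite /H !mulmxA TS -!mulmxA ST BP PB.
  apply: psd_conj; rewrite mxfunB; apply: psd_mxfun => j.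
  by rewrite mulr1 subr_ge0.
(* If [mu] were 0, then [B] and hence also [- D] would be both sides of 0 in the psd order. *)
have mu0 : mu != 0.
  apply: contra_neq D0 => mu0; move: pmu; rewrite mu0 scale0r sub0r => pNB.
  have B0 := psd_antisym pB pNB; apply: psd_antisym => //.
  by rewrite -[- D]add0r -[X in X - _]B0.
pose v : 'cV[C]_N := V^t* *m delta_mx i 0.
have Hv : H *m v = mu *: v.
  rewrite HE /mxfun /v !mulmxA mulmxtVK// -!mulmxA scalemxAr; congr (_ *m _).
  apply/matrixP => k l; rewrite mul_diag_mx !mxE ord1 andbT.
  by case: (k =P i) => [->|]; rewrite ?mulr1 ?mulr0.
have vv : (v^t* *m v) 0 0 = 1.
  rewrite /v adjmxM trmxCK !mulmxA mulmxtVK// trmx_delta map_delta_mx mul_delta_mx.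
  by rewrite mxE.
clearbody v.
have Pv : P *m v = v.
  by apply: (scalerI mu0); rewrite scalemxAr -Hv /H !mulmxA PS.
(* Three factors [S] are needed because [D = T *m T] cancels two of them, leaving [w = S *m v]. *)
exists mu, (S *m S *m S *m v) => /=.
have -> : D *m (S *m S *m S *m v) = S *m v.
  by rewrite !mulmxA -TT -(mulmxA T) TS -(mulmxA T) PS TS PS.
split => //; rewrite adjmxM SE.
  have -> : v^t* *m S *m B *m (S *m v) = v^t* *m (H *m v) by rewrite /H !mulmxA.
  by rewrite Hv -scalemxAr mxE vv mulr1.
have -> : v^t* *m S *m D *m (S *m v) = v^t* *m ((S *m T) *m (T *m S) *m v).
  by rewrite -TT !mulmxA.
by rewrite ST TS -mulmxA !Pv.
Qed.

(** This is the Kronecker product of the transpose of [phi] with [K]. The transpose matches the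
    pairing in [tr_choiM] and reverses the order of the first factors in [blockmxM]. *)
Definition blockmx N M (phi : 'M[C]_N) (K : 'M[C]_M) : 'M[C]_(\sum_(i < N) M) :=
  \mxblock_(i < N, j < N) (phi j i *: K).

Lemma blockmxM N M (phi1 phi2 : 'M[C]_N) (K1 K2 : 'M[C]_M) :
  blockmx phi1 K1 *m blockmx phi2 K2 = blockmx (phi2 *m phi1) (K1 *m K2).
Proof.
rewrite mul_mxblock; apply/eq_mxblock => i j; rewrite mxE scaler_suml.
by apply: eq_bigr => k _; rewrite -scalemxAl -scalemxAr scalerA mulrC.
Qed.

Lemma adj_blockmx N M (phi : 'M[C]_N) (K : 'M[C]_M) :
  (blockmx phi K)^t* = blockmx (phi^t*) (K^t*).
Proof. by apply/matrixP => i j; rewrite !mxE rmorphM. Qed.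

Lemma blockmxBr N M (phi : 'M[C]_N) (K L : 'M[C]_M) :
  blockmx phi (K - L) = blockmx phi K - blockmx phi L.
Proof. by apply/matrixP => i j; rewrite !mxE mulrBr. Qed.

Lemma blockmxZr N M (phi : 'M[C]_N) c (K : 'M[C]_M) :
  blockmx phi (c *: K) = c *: blockmx phi K.
Proof. by apply/matrixP => i j; rewrite !mxE mulrCA. Qed.

Lemma blockmx_sumr N M (phi : 'M[C]_N) I (r : seq I) (P : pred I) (F : I -> 'M[C]_M) :
  blockmx phi (\sum_(i <- r | P i) F i) = \sum_(i <- r | P i) blockmx phi (F i).
Proof.
apply/matrixP => i j; rewrite !mxE !summxE mulr_sumr.
by apply: eq_bigr => k _; rewrite !mxE.
Qed.

Definition choi N M (E : {linear 'M[C]_N -> 'M[C]_M}) : 'M[C]_(\sum_(i < N) M) :=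
  \mxblock_(i < N, j < N) E (delta_mx i j).

(** The Choi matrix is the blockwise image of [X *m X^t*], where [X] is the unnormalized maximally
    entangled vector; complete positivity is used with [r = N]. *)
Lemma psd_choi N M (E : {linear 'M[C]_N -> 'M[C]_M}) :
  completely_positive E -> psd (choi E).
Proof.
move=> cpE; pose X : 'M[C]_(\sum_(i < N) N, 1) := \mxcol_(i < N) delta_mx i 0.
have pX : psd (X *m X^t*) by rewrite -{1}(trmxCK X); exact: psd_gram.
rewrite /choi (_ : (\mxblock_(i < N, j < N) E (delta_mx i j)) =
  \mxblock_(i < N, j < N) E (submxblock (X *m X^t*) i j)); first exact: cpE.
apply/eq_mxblock => i j; congr (E _).
rewrite /X tr_mxcol (_ : map_mx _ _ = \mxrow_(i < N) delta_mx 0 i).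
  by rewrite mul_mxcol_mxrow mxblockK mul_delta_mx.
by apply/matrixP => k l; rewrite !mxE conjC_nat [in RHS]andbC.
Qed.

(** Expanding [phi] in matrix units shows that every expectation value after [E] is a linear
    functional of [choi E]. *)
Lemma tr_choiM N M (E : {linear 'M[C]_N -> 'M[C]_M}) phi K :
  \tr (choi E *m blockmx phi K) = \tr (E phi *m K).
Proof.
have -> : E phi = \sum_i \sum_j phi i j *: E (delta_mx i j).
  rewrite {1}(matrix_sum_delta phi) linear_sum; apply: eq_bigr => i _.
  by rewrite linear_sum; apply: eq_bigr => j _; rewrite linearZ.
rewrite mul_mxblock mxtrace_mxblock mulmx_suml raddf_sum; apply: eq_bigr => i _.
rewrite mulmx_suml !raddf_sum; apply: eq_bigr => j _ /=.
by rewrite -scalemxAr -scalemxAl.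
Qed.

Definition kraus N M (W : 'M[C]_(M, N)) : {linear 'M[C]_N -> 'M[C]_M} :=
  mulmxr (W^t*) \o mulmx W.

Lemma krausE N M (W : 'M[C]_(M, N)) A : kraus W A = W *m A *m W^t*.
Proof. by []. Qed.

(** The image of a matrix unit is a column of [W] times the adjoint of another column, so the Choi
    matrix has rank at most one. *)
Lemma choi_kraus N M (W : 'M[C]_(M, N)) :
  let w := \mxcol_(i < N) col i W in choi (kraus W) = w *m w^t*.
Proof.
rewrite /= tr_mxcol (_ : map_mx _ _ = \mxrow_(i < N) (col i W)^t*).
  rewrite mul_mxcol_mxrow; apply/eq_mxblock => i j.
  rewrite krausE -(mul_delta_mx (0 : 'I_1)) mulmxA -mulmxA -colE; congr (_ *m _).
  by rewrite colE adjmxM trmx_delta map_delta_mx.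
by apply/matrixP => k l; rewrite !mxE.
Qed.

Lemma kraus_cp N M (W : 'M[C]_(M, N)) : completely_positive (kraus W).
Proof.
move=> r A pA v.
have form (n : nat) (B : 'I_r -> 'I_r -> 'M[C]_n) (u : 'I_r -> 'cV[C]_n) :
    (\mxcol_(i < r) u i)^t* *m (\mxblock_(i < r, j < r) B i j) *m \mxcol_(i < r) u i =
    \sum_(j < r) \sum_(i < r) (u i)^t* *m B i j *m u j.
  rewrite tr_mxcol (_ : map_mx _ _ = \mxrow_(i < r) (u i)^t*).
    rewrite mul_mxrow_mxblock mul_mxrow_mxcol.
    by apply: eq_bigr => j _; rewrite mulmx_suml.
  by apply/matrixP => k l; rewrite !mxE.
rewrite -[v](@submxcolK _ _ (fun=> M)) form.
(* Moving [W] onto the vector turns the form of the image at [v] into the form of [A] at the blocks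
   [W^t* *m submxcol v i]. *)
have := pA (\mxcol_(i < r) (W^t* *m submxcol v i)).
rewrite -[A](@submxblockK _ _ _ (fun=> N) (fun=> N)) form.
congr (is_true (0 <= fun_of_matrix _ 0 0)).
apply: eq_bigr => j _; apply: eq_bigr => i _.
by rewrite submxblockK krausE adjmxM trmxCK !mulmxA.
Qed.

Lemma kraus_trace_le N M (W : 'M[C]_(M, N)) :
  \tr (W^t* *m W) <= 1 -> trace_nonincreasing (kraus W).
Proof.
move=> W1 A pA; rewrite krausE -mulmxA mxtrace_mulC -mulmxA.
apply: (le_trans (psd_trM_le pA (psd_gram W))).
by rewrite ler_piMr// psd_tr_ge0.
Qed.

End Choi.

(** * Optimal operations *)

Section SupportInverse.
Variable C : numClosedFieldType.

(** The eigenvalues of the support inverse are the [(a 0 i)^-1], with 0 on the kernel. Their maximum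
    is positive as [A] is nonzero, and its inverse is the least nonzero eigenvalue of [A]. *)
Lemma support_inv_max_eigenvalue n (A : 'M[C]_n) : psd A -> A != 0 ->
  exists lambda : C, [/\ is_max_eigenvalue (support_inv A) lambda, 0 < lambda &
    forall i, spectral_diag A 0 i != 0 -> 1 <= lambda * spectral_diag A 0 i].
Proof.
move=> pA A0; have Uu := spectral_unitarymx A.
set U := spectralmx A in Uu; set a := spectral_diag A.
have a0 i : 0 <= a 0 i by exact: psd_spectral_ge0.
have [i0 ai0] : exists i, a 0 i != 0.
  apply/existsP; apply: contraNT A0 => /existsPn a_eq0.
  apply/eqP/psd_tr_eq0 => //; rewrite psd_trE//; apply: big1 => i _.
  by apply/eqP; rewrite -[_ == _]negbK; exact: a_eq0.
have [|i imax] := @max_nonneg _ _ (fun i => (a 0 i)^-1) i0.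
  by move=> i; rewrite invr_ge0.
exists (a 0 i)^-1.
have lp : 0 < (a 0 i)^-1.
  by apply: lt_le_trans (imax i0); rewrite invr_gt0 lt0r ai0 a0.
split => //; last first.
  by move=> j aj; rewrite -ler_pdivrMr ?mul1r ?imax// lt0r aj a0.
have -> : support_inv A = U^t* *m diag_mx (map_mx (fun z => z^-1) a) *m U.
  by rewrite -invmx_unitary.
split.
  (* Eigenvectors in [eigenvalue] are row vectors; this one is row [i] of [U]. *)
  apply/eigenvalueP; exists (delta_mx 0 i *m U).
    rewrite !mulmxA mulmxtVK// scalemxAl; congr (_ *m _).
    apply/rowP => k; rewrite mul_mx_diag !mxE/= mulrC.
    by case: (k =P i) => [->|]; rewrite ?mulr1 ?mulr0.
  apply/eqP => /(congr1 (mulmx^~ (U^t*))); rewrite mulmxtVK// mul0mx.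
  by move/rowP/(_ i)/eqP; rewrite !mxE !eqxx oner_eq0.
move=> b /eigenvalueP[v vE v0].
pose u := v *m U^t*.
have uE : u *m diag_mx (map_mx (fun z => z^-1) a) = b *: u.
  by rewrite /u scalemxAl -vE !mulmxA mulmxtVK.
have /rV0Pn[j uj] : u != 0.
  apply: contra_neq v0 => u0.
  by rewrite -(mulmxKtV v Uu erefl) -/u u0 mul0mx.
clearbody u; move: uE => /rowP/(_ j); rewrite mul_mx_diag !mxE mulrC.
by move=> /(mulIf uj) <-; exact: imax.
Qed.

(** On the support projector [P] of [A] one has [P <= lambda *: A], and [W *m P = W] because [W]
    ends in a factor [A]. Pairing the inequality with [W^t* *m W] gives the claim. *)
Lemma tr_gram_le_support n m (A : 'M[C]_n) (V : 'M[C]_(m, n)) (lambda : C) :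
  psd A -> 0 <= lambda ->
  (forall i, spectral_diag A 0 i != 0 -> 1 <= lambda * spectral_diag A 0 i) ->
  let W := V *m A in \tr (W^t* *m W) <= lambda * \tr (W *m A *m W^t*).
Proof.
move=> pA l0 la; have Uu := spectral_unitarymx A.
set U := spectralmx A in Uu; set a := spectral_diag A in la.
pose P := mxfun U a (fun z => z * z^-1).
have DE : A = mxfun U a id by exact: psd_mxfunE.
have AP : A *m P = A.
  rewrite {1}DE mxfunM// DE; apply: eq_mxfun => i.
  have [->|an0] := eqVneq (a 0 i) 0; first by rewrite mul0r.
  by rewrite divff// mulr1.
have pP : psd (lambda *: A - P).
  rewrite DE mxfunZ mxfunB; apply: psd_mxfun => i.
  have [->|an0] := eqVneq (a 0 i) 0; first by rewrite !(mulr0, mul0r) subrr.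
  by rewrite divff// subr_ge0 la.
clearbody P; have : V *m A *m P = V *m A by rewrite -mulmxA AP.
move: (V *m A) => W WP /=.
have := psd_trM_ge0 pP (psd_gram W).
rewrite mulmxBl raddfB/= subr_ge0 -scalemxAl linearZ/=.
by rewrite mulmxA mxtrace_mulC mulmxA WP mxtrace_mulC mulmxA
  [X in _ <= _ * X]mxtrace_mulC mulmxA.
Qed.

End SupportInverse.

(** * Optimality for a general pair of forms *)

Section OptimalKraus.
Variable C : numClosedFieldType.

Lemma blockmx_eq0 N M (tau : 'M[C]_N) : (0 < M)%N -> psd tau ->
  blockmx tau (1%:M : 'M_M) = 0 -> tau = 0.
Proof.
move=> M0 pt D0; apply: psd_tr_eq0 => //; apply/eqP.
have : \tr (blockmx tau (1%:M : 'M_M)) = \tr tau * M%:R.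
  rewrite mxtrace_mxblock mulr_suml; apply: eq_bigr => i _.
  by rewrite mxtraceZ mxtrace1.
rewrite D0 mxtrace0 => /esym/eqP; rewrite mulf_eq0 pnatr_eq0.
by rewrite (gtn_eqF M0) orbF.
Qed.

(** Reading a block vector as a matrix turns the action of [blockmx tau 1%:M] into right
    multiplication by [tau]. A vector in the range of [D] thus becomes an operator of the form
    [V *m tau]. *)
Lemma submxcol_blockmx_mul N M (tau : 'M[C]_N) (u : 'cV[C]_(\sum_(i < N) M)) :
  let columns (w : 'cV[C]_(\sum_(i < N) M)) : 'M[C]_(M, N) :=
    \matrix_(a, i) submxcol w i a 0 in
  columns (blockmx tau 1%:M *m u) = columns u *m tau.
Proof.
apply/matrixP => a i; rewrite [LHS]mxE [RHS]mxE.
rewrite -{1}[u](@submxcolK _ _ (fun=> M)) mul_mxblock_mxrow mxcolK summxE.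
by apply: eq_bigr => j _; rewrite -scalemxAl mul1mx [LHS]mxE [in RHS]mxE mulrC.
Qed.

Lemma optimal_kraus N M (tau : 'M[C]_N) (B : 'M[C]_(\sum_(i < N) M)) :
  let D := blockmx tau 1%:M in
  (0 < M)%N -> psd tau -> tau != 0 -> psd B -> psd (D - B) ->
  exists E : {linear 'M[C]_N -> 'M[C]_M}, exists lambda : C,
    [/\ quantum_operation E, is_max_eigenvalue (support_inv tau) lambda,
        lambda != 0, \tr (choi E *m D) = 1 / lambda &
        forall E' : {linear 'M[C]_N -> 'M[C]_M}, completely_positive E' ->
          \tr (choi E' *m D) != 0 ->
          \tr (choi E' *m B) / \tr (choi E' *m D) <=
          \tr (choi E *m B) / \tr (choi E *m D)].
Proof.
move=> D M0 pt t0 pB pDB.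
have pD : psd D by rewrite -(subrK B D); exact: psdD.
have D0 : D != 0 by apply: contra_neq t0; exact: blockmx_eq0.
have [lambda [lmax l0 la]] := support_inv_max_eigenvalue pt t0.
(* The form [B + D] has the same maximizers relative to [D] as [B], but its
   maximal ratio is at least 1, so a maximizer exists in the range of [D]. *)
have [||mu [u]] := @psd_ratio_max C _ (B + D) D 2 pD D0.
- by rewrite addrK.
- by rewrite scaler_nat mulr2n (addrC B) addrKA.
set w := D *m u; move=> /= [pmu wB wD].
pose columns (w : 'cV[C]_(\sum_(i < N) M)) : 'M[C]_(M, N) :=
  \matrix_(a, i) submxcol w i a 0.
(* As [w] has [D]-form 1, scaling by the square root of [lambda^-1] makes the success probability
   equal to [lambda^-1]. *)
pose c := sqrtC lambda^-1.
have c0 : 0 <= c by rewrite sqrtC_ge0 invr_ge0 ltW.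
have cc : c * c^*%R = lambda^-1.
  by rewrite (CrealP (ger0_real c0)) -expr2 sqrtCK.
pose V := c *: columns u.
have WE : V *m tau = c *: columns w.
  by rewrite /V -scalemxAl -submxcol_blockmx_mul.
have choiE : choi (kraus (V *m tau)) = lambda^-1 *: (w *m w^t*).
  rewrite choi_kraus WE.
  have -> : \mxcol_(i < N) col i (c *: columns w) = c *: w.
    rewrite -[in RHS](@submxcolK _ _ (fun=> M) _ w).
    by apply/matrixP => i j; rewrite !mxE ord1.
  by rewrite [(c *: w)^T]linearZ/= map_mxZ -scalemxAl -scalemxAr scalerA cc.
have trw G : \tr (choi (kraus (V *m tau)) *m G) = lambda^-1 * (w^t* *m G *m w) 0 0.
  rewrite choiE -scalemxAl mxtraceZ -mulmxA mxtrace_mulC.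
  by rewrite /mxtrace big_ord1.
have denE : \tr (choi (kraus (V *m tau)) *m D) = lambda^-1 by rewrite trw wD mulr1.
exists (kraus (V *m tau)), lambda; split => //.
- split; first exact: kraus_cp.
  apply: kraus_trace_le.
  apply: le_trans (tr_gram_le_support V pt (ltW l0) la) _.
  have -> : \tr (V *m tau *m tau *m (V *m tau)^t*) = lambda^-1.
    by rewrite -denE tr_choiM mulmx1.
  by rewrite divff// gt_eqF.
- by rewrite gt_eqF.
- by rewrite denE mul1r.
move=> E' cpE' den0.
have pJ := psd_choi cpE'.
have den_gt0 : 0 < \tr (choi E' *m D) by rewrite lt0r den0 psd_trM_ge0.
(* The value [mu] belongs to [B + D], so subtracting the [D]-form of [w] leaves [mu - 1] for [B]. *)
have -> : \tr (choi (kraus (V *m tau)) *m B) = lambda^-1 * (mu - 1).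
  rewrite trw; congr (_ * _); apply/eqP; rewrite eq_sym subr_eq -wD -wB; apply/eqP.
  by rewrite mulmxDr mulmxDl mxE.
rewrite denE mulrAC divff ?mul1r; last by rewrite invr_eq0 gt_eqF.
(* After clearing the denominator the claim is the nonnegativity of the trace of [choi E'] against
   [mu *: D - (B + D)]. *)
rewrite ler_pdivrMr// mulrBl mul1r lerBrDr -mxtraceD -mulmxDr -subr_ge0.
have := psd_trM_ge0 pJ pmu.
by rewrite mulmxBr raddfB/= -scalemxAr mxtraceZ.
Qed.

End OptimalKraus.

(** * Tensor products and orthogonal projectors *)

Section TensorLemmas.
Variables (C : numClosedFieldType) (d : nat).

Lemma sum_multi_index n (F : {ffun 'I_n -> 'I_d} -> C) :
  \sum_(i < tdim d n) F (multi_index i) = \sum_f F f.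
Proof. by rewrite -(big_enum_val (A := {: {ffun 'I_n -> 'I_d}})). Qed.

(** The sum over multi-indices of a product factors by distributivity into a product of sums over
    single indices. *)
Lemma tensorM n (A B : 'I_n -> 'M[C]_d) :
  tensor A *m tensor B = tensor (fun a => A a *m B a).
Proof.
apply/matrixP => i j; rewrite !mxE.
under eq_bigr => k _ do rewrite !mxE -big_split/=.
rewrite (sum_multi_index (fun f =>
  \prod_(a < n) (A a (multi_index i a) (f a) * B a (f a) (multi_index j a)))).
rewrite -(bigA_distr_bigA (fun a c =>
  A a (multi_index i a) c * B a c (multi_index j a))).
by apply: eq_bigr => a _; rewrite mxE.
Qed.

Lemma adj_tensor n (A : 'I_n -> 'M[C]_d) :
  (tensor A)^t* = tensor (fun a => (A a)^t*).
Proof.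
apply/matrixP => i j; rewrite !mxE rmorph_prod.
by apply: eq_bigr => a _; rewrite !mxE.
Qed.

Lemma tr_tensor n (A : 'I_n -> 'M[C]_d) : \tr (tensor A) = \prod_(a < n) \tr (A a).
Proof.
rewrite /mxtrace; under eq_bigr => k _ do rewrite mxE.
rewrite (sum_multi_index (fun f => \prod_(a < n) A a (f a) (f a))).
by rewrite -(bigA_distr_bigA (fun a c => A a c c)).
Qed.

Lemma eq_tensor n (A B : 'I_n -> 'M[C]_d) : A =1 B -> tensor A = tensor B.
Proof.
by move=> AB; apply/matrixP => i j; rewrite !mxE; apply: eq_bigr => a _; rewrite AB.
Qed.

(** Projectors pass through [tensor] and [blockmx] by multiplicativity alone, which gives positivity
    of these products without a spectral argument. *)
Definition projector n (A : 'M[C]_n) := A^t* = A /\ A *m A = A.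

Lemma projector_psd n (A : 'M[C]_n) : projector A -> psd A.
Proof. by case; exact: psd_proj. Qed.

Lemma projector1 n : projector (1%:M : 'M[C]_n).
Proof. by split; rewrite ?adjmx1 ?mulmx1. Qed.

Lemma projectorC n (A : 'M[C]_n) : projector A -> projector (1%:M - A).
Proof.
move=> [hA iA]; split; first by rewrite adjmxB adjmx1 hA.
by rewrite mulmxBr mulmx1 mulmxBl mul1mx iA subrr subr0.
Qed.

Lemma projector_tensor n (A : 'I_n -> 'M[C]_d) :
  (forall a, projector (A a)) -> projector (tensor A).
Proof.
move=> pA; split; first by rewrite adj_tensor; apply: eq_tensor => a; case: (pA a).
by rewrite tensorM; apply: eq_tensor => a; case: (pA a).
Qed.

Lemma projector_blockmx N M (phi : 'M[C]_N) (K : 'M[C]_M) :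
  projector phi -> projector K -> projector (blockmx phi K).
Proof.
by move=> [h1 h2] [h3 h4]; split; rewrite ?adj_blockmx ?blockmxM ?h1 ?h2 ?h3 ?h4.
Qed.

Lemma projector_proj (v : 'cV[C]_d) : v^t* *m v = 1%:M -> projector (Defs.proj v).
Proof.
move=> v1; split; first by rewrite /Defs.proj adjmxM trmxCK.
by rewrite /Defs.proj mulmxA -(mulmxA v) v1 mulmx1.
Qed.

Lemma tr_tensor_power_proj n (v : 'cV[C]_d) : v^t* *m v = 1%:M ->
  \tr (tensor_power n (Defs.proj v)) = 1.
Proof.
move=> v1; rewrite tr_tensor; apply: big1 => a _.
by rewrite /Defs.proj mxtrace_mulC v1 mxtrace1.
Qed.

End TensorLemmas.

(** * The two forms of the cloning problem *)

Section Optimum.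
Variables (R : realType) (d : nat) (X : choiceType).
Variables (p : X -> R) (psi : X -> 'cV[R[i]]_d) (n m k : nat).
Hypothesis p_prior : is_prior p.
Hypothesis psi_unit : forall x, (psi x)^t* *m psi x = 1%:M.
Hypothesis le_km : (k <= m)%N.

Let phi x : 'M[R[i]]_(tdim d n) := tensor_power n (Defs.proj (psi x)).
Let tau := avg_input p psi n.

(** The observable whose expectation in the output is the [k]-copy score averaged over groups of
    clones. *)
Definition clone_test x : 'M[R[i]]_(tdim d m) :=
  ('C(m, k)%:R)^-1 *: \sum_(S : {set 'I_m} | #|S| == k) acting_on S (Defs.proj (psi x)).

Definition success_form := mavg p (fun x => blockmx (phi x) (1%:M : 'M_(tdim d m))).
Definition fidelity_form := mavg p (fun x => blockmx (phi x) (clone_test x)).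

(** A squared modulus is one term of the squared norm 1. The boundedness of every family averaged
    below rests on this. *)
Lemma cbounded_unit i : cbounded (fun x => psi x i 0).
Proof.
have psi1 x : `|psi x i 0| <= 1.
  have /matrixP/(_ 0 0) := psi_unit x; rewrite !mxE/= => e.
  rewrite -(@ler_pXn2r _ 2)// ?nnegrE// expr1n normCK -[leRHS]e.
  rewrite (bigD1 i)//= !mxE mulrC lerDl; apply: sumr_ge0 => j _.
  by rewrite !mxE mulrC mul_conjC_ge0.
split; exists 1 => x; rewrite -lecR; apply: le_trans (psi1 x).
  exact: normc_ge_Re.
case: (psi x i 0) => a b; rewrite normc_def lecR/= -sqrtr_sqr ler_wsqrtr//.
by rewrite lerDr sqr_ge0.
Qed.

Lemma mbounded_proj : mbounded (fun x => Defs.proj (psi x)).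
Proof.
move=> i j; rewrite (_ : (fun x => _) = fun x => psi x i 0 * (psi x j 0)^*%R).
  by apply: cboundedM; [|apply: cbounded_conj]; exact: cbounded_unit.
by apply/funext => x; rewrite mxE big_ord1 !mxE.
Qed.

Lemma mbounded_tensor r (A : X -> 'I_r -> 'M[R[i]]_d) :
  (forall a, mbounded (fun x => A x a)) -> mbounded (fun x => tensor (A x)).
Proof.
move=> bA i j; rewrite (_ : (fun x => _) = fun x => \prod_(a < r)
  A x a (multi_index i a) (multi_index j a)).
  by apply: cbounded_prod => a; exact: bA.
by apply/funext => x; rewrite mxE.
Qed.

Lemma mbounded_phi : mbounded phi.
Proof. by apply: mbounded_tensor => a; exact: mbounded_proj. Qed.

Lemma mbounded_clone_test : mbounded clone_test.
Proof.
apply: mboundedZ; apply: mbounded_sum => S _; apply: mbounded_tensor => a.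
by case: (a \in S); [exact: mbounded_proj|exact: mbounded_cst].
Qed.

Lemma mbounded_blockmx N M (F : X -> 'M[R[i]]_N) (G : X -> 'M[R[i]]_M) :
  mbounded F -> mbounded G -> mbounded (fun x => blockmx (F x) (G x)).
Proof.
move=> bF bG i j; rewrite (_ : (fun x => _) = fun x =>
  F x (tagnat.sig1 j) (tagnat.sig1 i) * G x (tagnat.sig2 i) (tagnat.sig2 j)).
  exact: cboundedM.
by apply/funext => x; rewrite !mxE.
Qed.

Lemma projector_phi x : projector (phi x).
Proof. by apply: projector_tensor => a; exact: projector_proj. Qed.

Lemma projector_acting_on x (S : {set 'I_m}) :
  projector (acting_on S (Defs.proj (psi x))).
Proof.
apply: projector_tensor => a; case: (a \in S); last exact: projector1.
exact: projector_proj.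
Qed.

Let bin_neq0 : 'C(m, k)%:R != 0 :> R[i].
Proof. by rewrite pnatr_eq0 -lt0n bin_gt0. Qed.

Lemma psd_block_clone_test x : psd (blockmx (phi x) (clone_test x)).
Proof.
rewrite blockmxZr blockmx_sumr; apply: psdZ; first by rewrite invr_ge0.
apply: psd_sum => S _; apply/projector_psd/projector_blockmx.
  exact: projector_phi.
exact: projector_acting_on.
Qed.

(** There are ['C(m, k)] subsets [S], so [1%:M - clone_test x] is the average of the complementary
    projectors. *)
Lemma psd_block_clone_testC x : psd (blockmx (phi x) (1%:M - clone_test x)).
Proof.
have -> : 1%:M - clone_test x = ('C(m, k)%:R)^-1 *:
    \sum_(S : {set 'I_m} | #|S| == k) (1%:M - acting_on S (Defs.proj (psi x))).
  rewrite big_split/= scalerDr sumrN scalerN sumr_const; congr (_ - _).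
  have -> : #|[pred S : {set 'I_m} | #|S| == k]| = 'C(m, k).
    by rewrite -[in RHS](card_ord m) -card_draws cardsE.
  by rewrite -[1%:M *+ _]scaler_nat scalerA mulVf// scale1r.
rewrite blockmxZr blockmx_sumr; apply: psdZ; first by rewrite invr_ge0.
apply: psd_sum => S _; apply/projector_psd/projector_blockmx.
  exact: projector_phi.
exact/projectorC/projector_acting_on.
Qed.

Let bD : mbounded (fun x => blockmx (phi x) (1%:M : 'M_(tdim d m))).
Proof. by apply: mbounded_blockmx; [exact: mbounded_phi|exact: mbounded_cst]. Qed.

Let bB : mbounded (fun x => blockmx (phi x) (clone_test x)).
Proof. by apply: mbounded_blockmx; [exact: mbounded_phi|exact: mbounded_clone_test]. Qed.

Lemma psd_fidelity_form : psd fidelity_form.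
Proof. by apply: psd_mavg => // x; exact: psd_block_clone_test. Qed.

Lemma fidelity_form_le : psd (success_form - fidelity_form).
Proof.
pose F x := blockmx (phi x) (1%:M - clone_test x).
have bF : mbounded F.
  apply: mbounded_blockmx; first exact: mbounded_phi.
  rewrite (_ : (fun x => _) = fun x => 1%:M + (-1) *: clone_test x).
    apply: mboundedD; first exact: mbounded_cst.
    exact/mboundedZ/mbounded_clone_test.
  by apply/funext => x; rewrite scaleN1r.
have -> : success_form = mavg p F + fidelity_form.
  rewrite -(mavgD p_prior bF bB); congr mavg.
  by apply/funext => x; rewrite /F blockmxBr subrK.
rewrite addrK; apply: psd_mavg => // x; exact: psd_block_clone_testC.
Qed.

Lemma success_formE : success_form = blockmx tau 1%:M.
Proof.
apply/matrixP => i j; rewrite !mxE mulrC -avgZ//; last exact: mbounded_phi.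
by congr avg; apply/funext => x; rewrite !mxE mulrC.
Qed.

Lemma psd_avg_input : psd tau.
Proof.
apply: psd_mavg => // [|x]; first exact: mbounded_phi.
exact/projector_psd/projector_phi.
Qed.

Lemma tr_avg_input : \tr tau = 1.
Proof.
transitivity (avg p (fun x => \tr (phi x))).
  by apply: (tr_mavg p_prior); exact: mbounded_phi.
rewrite -[RHS](avg_cst p_prior); congr avg; apply/funext => x.
exact: tr_tensor_power_proj.
Qed.

(** By [tr_choiM] each term is a trace against [choi E]; linearity moves the average inside. *)
Lemma success_prob_choi (E : {linear 'M[R[i]]_(tdim d n) -> 'M[R[i]]_(tdim d m)}) :
  success_prob p psi E = \tr (choi E *m success_form).
Proof.
rewrite -mavgMl// tr_mavg//; last by apply: mboundedM => //; exact: mbounded_cst.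
by congr avg; apply/funext => x; rewrite tr_choiM mulmx1.
Qed.

Lemma cloning_fidelity_choi
    (E : {linear 'M[R[i]]_(tdim d n) -> 'M[R[i]]_(tdim d m)}) :
  cloning_fidelity p psi E k =
  \tr (choi E *m fidelity_form) / \tr (choi E *m success_form).
Proof.
rewrite /cloning_fidelity; congr (_ / _); last exact: success_prob_choi.
rewrite -mavgMl// tr_mavg//; last first.
  by apply: mboundedM => //; exact: mbounded_cst.
congr avg; apply/funext => x; rewrite tr_choiM mxtrace_mulC.
by rewrite -scalemxAl mxtraceZ mulmx_suml raddf_sum.
Qed.

End Optimum.

Unset Implicit Arguments.
Set Strict Implicit.
Set Printing Implicit Defensive.

Theorem lemma1 (R : realType) (d : nat) (X : choiceType)
    (p : X -> R) (psi : X -> 'cV[R[i]]_d) (n m k : nat)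
    (p_prior : is_prior p)
    (psi_unit : forall x, (psi x)^t* *m psi x = 1%:M)
    (n_ge1 : (1 <= n)%N) (k_ge1 : (1 <= k)%N) (le_km : (k <= m)%N) :
  exists E : {linear 'M[R[i]]_(tdim d n) -> 'M[R[i]]_(tdim d m)},
    [/\ quantum_operation E,
        success_prob p psi E != 0,
        forall E' : {linear 'M[R[i]]_(tdim d n) -> 'M[R[i]]_(tdim d m)},
          quantum_operation E' -> success_prob p psi E' != 0 ->
          cloning_fidelity p psi E' k <= cloning_fidelity p psi E k
      & exists2 lambda : R[i],
          is_max_eigenvalue (support_inv (avg_input p psi n)) lambda
          & success_prob p psi E = 1 / lambda].
Proof.
have tr1 := tr_avg_input n p_prior psi_unit.
have t0 : avg_input p psi n != 0.
  by apply/eqP => t0; move/eqP: tr1; rewrite t0 mxtrace0 eq_sym oner_eq0.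
have M0 : (0 < tdim d m)%N.
  rewrite /tdim card_ffun !card_ord expn_gt0; case: (posnP d) => //= d0.
  (* In dimension [d = 0], [n >= 1] would make the input space zero and contradict the unit trace of
     the average input. *)
  have e : tdim d n = 0%N by rewrite /tdim card_ffun !card_ord d0 exp0n.
  move: tr1; rewrite /mxtrace big1 => [/eqP|]; first by rewrite eq_sym oner_eq0.
  by case=> i lti; exfalso; move: lti; rewrite e.
have [] := @optimal_kraus _ _ _ (avg_input p psi n) (fidelity_form p psi n m k) M0.
- exact: psd_avg_input.
- exact: t0.
- exact: psd_fidelity_form.
- by rewrite -success_formE//; exact: fidelity_form_le.
move=> E [lambda [qE lmax l0 denE best]]; exists E.
rewrite !success_prob_choi// success_formE// denE; split => //.
- by rewrite mul1r invr_eq0.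
- move=> E' [cpE' _]; rewrite success_prob_choi// !cloning_fidelity_choi//.
  by rewrite success_formE//; exact: best.
- by exists lambda.
Qed.
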